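(* Let $A\in M_n(\mathbb{C})$. The quaternionic and the complex numerical radius of $A$ coincide, i.e. $w_{\mathbb{H}}(A)=w_{\mathbb{C}}(A)$.
   Context: $\mathbb{H}$ denotes the Hamilton quaternions with real basis $1,i,j,k$, and $\mathbb{C}=\mathrm{span}_{\mathbb{R}}\{1,i\}\subset\mathbb{H}$. For $\mathbb{F}=\mathbb{C}$ or $\mathbb{H}$ and $A\in M_n(\mathbb{F})$, the numerical range is $W_{\mathbb{F}}(A)=\{\boldsymbol{x}^*A\boldsymbol{x}:\boldsymbol{x}\in\mathbb{F}^n,\ \boldsymbol{x}^*\boldsymbol{x}=1\}$, where $\boldsymbol{x}$ is a column vector and $^*$ denotes conjugate transpose, and the numerical radius is $w_{\mathbb{F}}(A)=\max\{|z|:z\in W_{\mathbb{F}}(A)\}$. A complex matrix is regarded as a quaternionic matrix. *)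

(* Defs.v *)
From HB Require Import structures.
From mathcomp Require Import all_boot all_order all_algebra.
From mathcomp Require Import boolp classical_sets reals.
From mathcomp Require Import complex.
From mathcomp Require Import ring.

Set Implicit Arguments.
Unset Strict Implicit.
Unset Printing Implicit Defensive.

Import Order.TTheory GRing.Theory Num.Theory.

Local Open Scope classical_set_scope.
Local Open Scope ring_scope.

(* [Quat a b c d] is a + b i + c j + d k. *)
Record quat (R : Type) : Type := Quat { qre : R; qi : R; qj : R; qk : R }.

Section QuatEncoding.
Variable R : Type.

Definition quat_encode (p : quat R) : R * R * R * R :=
  (qre p, qi p, qj p, qk p).
Definition quat_decode (u : R * R * R * R) : quat R :=
  let: (a, b, c, d) := u in Quat a b c d.

Lemma quat_encodeK : cancel quat_encode quat_decode.
Proof. by case. Qed.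

End QuatEncoding.

HB.instance Definition _ (R : eqType) :=
  Equality.copy (quat R) (can_type (@quat_encodeK R)).
HB.instance Definition _ (R : choiceType) :=
  Choice.copy (quat R) (can_type (@quat_encodeK R)).

Section QuatRing.
Variable R : comNzRingType.
Implicit Types p q r : quat R.

Definition quat_zero : quat R := Quat 0 0 0 0.
Definition quat_one : quat R := Quat 1 0 0 0.
Definition quat_opp p := Quat (- qre p) (- qi p) (- qj p) (- qk p).
Definition quat_add p q :=
  Quat (qre p + qre q) (qi p + qi q) (qj p + qj q) (qk p + qk q).

(* Hamilton product: i^2 = j^2 = k^2 = ijk = -1. *)
Definition quat_mul p q :=
  Quat (qre p * qre q - qi p * qi q - qj p * qj q - qk p * qk q)
       (qre p * qi q + qi p * qre q + qj p * qk q - qk p * qj q)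
       (qre p * qj q - qi p * qk q + qj p * qre q + qk p * qi q)
       (qre p * qk q + qi p * qj q - qj p * qi q + qk p * qre q).

Fact quat_addA : associative quat_add.
Proof. by move=> [? ? ? ?] [? ? ? ?] [? ? ? ?]; rewrite /quat_add /= !addrA. Qed.
Fact quat_addC : commutative quat_add.
Proof. by move=> p q; congr Quat; exact: addrC. Qed.
Fact quat_add0 : left_id quat_zero quat_add.
Proof. by case=> ? ? ? ?; rewrite /quat_add /= !add0r. Qed.
Fact quat_addN : left_inverse quat_zero quat_opp quat_add.
Proof. by case=> ? ? ? ?; rewrite /quat_add /= !addNr. Qed.

HB.instance Definition _ :=
  GRing.isZmodule.Build (quat R) quat_addA quat_addC quat_add0 quat_addN.

Fact quat_mulA : associative quat_mul.
Proof. by move=> [? ? ? ?] [? ? ? ?] [? ? ? ?]; congr Quat => /=; ring. Qed.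
Fact quat_mul1l : left_id quat_one quat_mul.
Proof. by case=> ? ? ? ?; congr Quat => /=; ring. Qed.
Fact quat_mul1r : right_id quat_one quat_mul.
Proof. by case=> ? ? ? ?; congr Quat => /=; ring. Qed.
Fact quat_mulDl : left_distributive quat_mul +%R.
Proof. by move=> [? ? ? ?] [? ? ? ?] [? ? ? ?]; congr Quat => /=; ring. Qed.
Fact quat_mulDr : right_distributive quat_mul +%R.
Proof. by move=> [? ? ? ?] [? ? ? ?] [? ? ? ?]; congr Quat => /=; ring. Qed.
Fact quat_one_neq0 : quat_one != 0.
Proof. by apply/eqP => -[] /eqP; rewrite oner_eq0. Qed.

HB.instance Definition _ := GRing.Zmodule_isNzRing.Build (quat R)
  quat_mulA quat_mul1l quat_mul1r quat_mulDl quat_mulDr quat_one_neq0.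

Definition quat_conj p : quat R := Quat (qre p) (- qi p) (- qj p) (- qk p).

End QuatRing.

Definition quat_norm (R : rcfType) (p : quat R) : R :=
  Num.sqrt (qre p ^+ 2 + qi p ^+ 2 + qj p ^+ 2 + qk p ^+ 2).

(* The embedding of C as span {1, i}. *)
Definition quat_of_complex (R : rcfType) (z : R[i]) : quat R :=
  Quat (complex.Re z) (complex.Im z) 0 0.

Section NumericalRange.
Variables (R : realType) (F : nzRingType) (conj : F -> F) (norm : F -> R).

Definition ctrmx m n (A : 'M[F]_(m, n)) : 'M[F]_(n, m) := (map_mx conj A)^T.

Definition numerical_range n (A : 'M[F]_n) : set F :=
  [set (ctrmx x *m A *m x) 0 0 | x in [set x : 'cV[F]_n | ctrmx x *m x = 1%:M]].

(* The greatest element of [S]; the value is 0 if [S] has none, which does not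
   happen for the sets of moduli below when n > 0, since they are continuous
   images of a nonempty compact sphere. *)
Definition maximum (S : set R) : R := xget 0 (S `&` ubound S).

Definition numerical_radius n (A : 'M[F]_n) : R :=
  maximum [set norm z | z in numerical_range A].

End NumericalRange.

Section RangesAndRadii.
Variables (R : realType) (n : nat).

Definition numerical_rangeC (A : 'M[R[i]]_n) : set R[i] :=
  numerical_range (@conjc R) A.
Definition numerical_radiusC (A : 'M[R[i]]_n) : R :=
  numerical_radius (@conjc R) (@Normc.normc R) A.

Definition numerical_rangeH (A : 'M[quat R]_n) : set (quat R) :=
  numerical_range (@quat_conj R) A.
Definition numerical_radiusH (A : 'M[quat R]_n) : R :=
  numerical_radius (@quat_conj R) (@quat_norm R) A.

End RangesAndRadii.

(* Main.v *)
Require Import Defs.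
From HB Require Import structures.
From mathcomp Require Import all_boot all_order all_algebra.
From mathcomp Require Import boolp classical_sets reals.
From mathcomp Require Import complex.
From mathcomp Require Import ring.

(** Write a quaternionic vector as [x = u + v j] with [u], [v] complex.  The
    complex component of [x^* A x] is [u^* A u + conj (v^* A v)].  Replacing [x]
    by [x p] with [p] a unit quaternion conjugates [x^* A x] by [p], so [p] can
    be chosen to make [x^* A x] complex; then
    [|x^* A x| <= |u^* A u| + |v^* A v|], and since [|u|^2 + |v|^2 = 1] the
    normalization of [u] or of [v] gives a value of the complex numerical range
    of modulus at least [|x^* A x|].  As the complex moduli are also
    quaternionic ones, the two sets of moduli dominate each other and have the same maximum;
    no compactness is needed. *)

Set Implicit Arguments.
Unset Strict Implicit.

Import Order.TTheory GRing.Theory Num.Theory.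
Import Normc.

Local Open Scope ring_scope.

Section Quaternions.
Variable R : rcfType.
Implicit Types p q : quat R.

(** Complex coordinates with [j] on the right: [p = cpart p + jpart p * j]. *)
Definition cpart p : R[i] := Complex (qre p) (qi p).
Definition jpart p : R[i] := Complex (qj p) (qk p).

Lemma cpart_is_zmod_morphism : zmod_morphism cpart.
Proof. by []. Qed.
HB.instance Definition _ :=
  GRing.isZmodMorphism.Build (quat R) R[i] cpart cpart_is_zmod_morphism.

Lemma quat_of_complex_is_zmod_morphism : zmod_morphism (@quat_of_complex R).
Proof. by move=> [a b] [c d]; congr Quat => /=; ring. Qed.
HB.instance Definition _ :=
  GRing.isZmodMorphism.Build R[i] (quat R) (@quat_of_complex R)
    quat_of_complex_is_zmod_morphism.

Lemma quat_of_complex_is_monoid_morphism :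
  monoid_morphism (@quat_of_complex R).
Proof. by split=> [|[a b] [c d]]; congr Quat => /=; ring. Qed.
HB.instance Definition _ :=
  GRing.isMonoidMorphism.Build R[i] (quat R) (@quat_of_complex R)
    quat_of_complex_is_monoid_morphism.

Lemma quat_conj_complex (z : R[i]) :
  quat_conj (quat_of_complex z) = quat_of_complex z^*%C.
Proof. by case: z => a b; congr Quat => /=; ring. Qed.

Lemma quat_conjM p q : quat_conj (p * q) = quat_conj q * quat_conj p.
Proof. by case: p q => [? ? ? ?] [? ? ? ?]; congr Quat => /=; ring. Qed.

(** Moving [j] past a complex number conjugates it, and [j^2 = -1], so the two [j]-parts contribute
    the conjugate of a complex product. *)
Lemma cpart_conj_mul (z : R[i]) p q :
  cpart (quat_conj p * quat_of_complex z * q) =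
  (cpart p)^*%C * z * cpart q + ((jpart p)^*%C * z * jpart q)^*%C.
Proof.
case: z p q => [? ?] [? ? ? ?] [? ? ? ?].
by congr Complex => /=; ring.
Qed.

Lemma quat_normM p q : quat_norm (p * q) = quat_norm p * quat_norm q.
Proof.
rewrite /quat_norm -sqrtrM ?addr_ge0 ?sqr_ge0 //; congr Num.sqrt.
by case: p q => [? ? ? ?] [? ? ? ?] /=; ring.
Qed.

Lemma quat_norm_conj p : quat_norm (quat_conj p) = quat_norm p.
Proof. by rewrite /quat_norm /= !sqrrN. Qed.

Lemma quat_norm_cpart p : jpart p = 0 -> quat_norm p = normc (cpart p).
Proof.
by case: p => a b c d [] /= -> ->; rewrite /quat_norm /= expr0n /= !addr0.
Qed.

Lemma quat_norm_complex (z : R[i]) : quat_norm (quat_of_complex z) = normc z.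
Proof. by case: z => a b; rewrite quat_norm_cpart. Qed.

Lemma quat_conj_mulE p : quat_conj p * p =
  quat_of_complex (quat_norm p ^+ 2)%:C%C.
Proof.
rewrite sqr_sqrtr ?addr_ge0 ?sqr_ge0 //.
by case: p => ? ? ? ?; congr Quat => /=; ring.
Qed.

(* With [v] the vector part of [q] and [t = |v|], the quaternion [p = t - v i]
   satisfies [v p = p (t i)]; it vanishes only for [v = - t i]. *)
Lemma quat_conj_to_complex q :
  exists2 p, quat_norm p = 1 & jpart (quat_conj p * q * p) = 0.
Proof.
have [q0|qN0] := eqVneq (jpart q) 0.
  exists 1; last first.
    case: q q0 => a b c d /= [-> ->].
    by congr Complex => /=; ring.
  by rewrite /quat_norm /= expr1n !expr0n /= !addr0 sqrtr1.
case: q qN0 => a b c d qN0.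
have cd_gt0 : 0 < c ^+ 2 + d ^+ 2.
  rewrite lt0r addr_ge0 ?sqr_ge0 // andbT paddr_eq0 ?sqr_ge0 // !sqrf_eq0.
  by apply: contraNN qN0 => /andP[/eqP c0 /eqP d0]; rewrite /jpart /= c0 d0.
set t := Num.sqrt (b ^+ 2 + c ^+ 2 + d ^+ 2).
have t2 : t ^+ 2 = b ^+ 2 + c ^+ 2 + d ^+ 2.
  by rewrite sqr_sqrtr ?addr_ge0 ?sqr_ge0.
set p0 := Quat (t + b) 0 (- d) c.
have n2 : quat_norm p0 ^+ 2 = (t + b) ^+ 2 + c ^+ 2 + d ^+ 2.
  by rewrite sqr_sqrtr ?addr_ge0 ?sqr_ge0 //=; ring.
have n_gt0 : 0 < quat_norm p0.
  rewrite lt0r sqrtr_ge0 andbT -sqrf_eq0 n2 gt_eqF // -addrA.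
  by rewrite ltr_wpDl ?sqr_ge0.
pose s : R := (quat_norm p0)^-1.
exists (p0 * quat_of_complex s%:C%C).
  rewrite quat_normM quat_norm_complex /= expr0n addr0 sqrtr_sqr.
  by rewrite ger0_norm ?invr_ge0 ?ltW // mulfV ?gt_eqF.
(* Both components are [s ^+ 2] times a polynomial that vanishes modulo [t2]. *)
by congr Complex => /=; ring: t2.
Qed.

End Quaternions.

Section QuadraticForm.
Variables (F : nzRingType) (conj : F -> F) (n : nat).
Implicit Types (A : 'M[F]_n) (x : 'cV[F]_n).

Definition qform A x : F := (ctrmx conj x *m A *m x) 0 0.

Lemma qformE A x :
  qform A x = \sum_i \sum_j conj (x j 0) * A j i * x i 0.
Proof.
rewrite /qform mxE; apply: eq_bigr => i _; rewrite mxE mulr_suml.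
by apply: eq_bigr => j _; rewrite !mxE.
Qed.

(** The unit-vector constraint becomes a value of the form, so identities for [qform] also track
    norms. *)
Lemma qform_unit x : (ctrmx conj x *m x = 1%:M) <-> (qform 1%:M x = 1).
Proof.
rewrite /qform mulmx1; split=> [->|x1]; first by rewrite mxE eqxx.
by rewrite [LHS]mx11_scalar x1.
Qed.

End QuadraticForm.

Section Forms.
Variables (R : realType) (n : nat).
Implicit Types (A : 'M[R[i]]_n) (x : 'cV[quat R]_n) (y : 'cV[R[i]]_n).

Local Notation qformC := (qform (@conjc R)).
Local Notation qformH := (qform (@quat_conj R)).
Local Notation toH := (map_mx (@quat_of_complex R)).

Lemma qformH_complex A y : qformH (toH A) (toH y) =
  quat_of_complex (qformC A y).
Proof.
rewrite !qformE rmorph_sum; apply: eq_bigr => i _.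
rewrite rmorph_sum; apply: eq_bigr => j _.
by rewrite !mxE quat_conj_complex -!rmorphM.
Qed.

(** Scaling from the right is written as a product with a 1 by 1 matrix, since [*:] acts from the
    left. *)
Lemma qformH_mulr (B : 'M[quat R]_n) x (p : quat R) :
  qformH B (x *m p%:M) = quat_conj p * qformH B x * p.
Proof.
rewrite !qformE mulr_sumr mulr_suml; apply: eq_bigr => i _.
rewrite mulr_sumr mulr_suml; apply: eq_bigr => j _.
by rewrite !mxE !big_ord1 !mxE eqxx !mulr1n quat_conjM !mulrA.
Qed.

Lemma cpart_qformH A x :
  cpart (qformH (toH A) x) =
  qformC A (map_mx (@cpart R) x) + (qformC A (map_mx (@jpart R) x))^*%C.
Proof.
rewrite !qformE !raddf_sum -big_split; apply: eq_bigr => i _.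
rewrite !raddf_sum -big_split; apply: eq_bigr => j _.
by rewrite !mxE; apply: cpart_conj_mul.
Qed.

Lemma qformC_scale A y (c : R) :
  qformC A (c%:C%C *: y) = (c ^+ 2)%:C%C * qformC A y.
Proof.
rewrite !qformE mulr_sumr; apply: eq_bigr => i _.
rewrite mulr_sumr; apply: eq_bigr => j _.
rewrite !mxE; case: (y j 0) (A j i) (y i 0) => [? ?] [? ?] [? ?].
by congr Complex => /=; ring.
Qed.

Definition sqnorm y : R := \sum_i normc (y i 0) ^+ 2.

Lemma sqnorm_ge0 y : 0 <= sqnorm y.
Proof. by apply: sumr_ge0 => i _; apply: sqr_ge0. Qed.

Lemma sqnorm0_eq0 y : sqnorm y = 0 -> y = 0.
Proof.
move=> /eqP; rewrite psumr_eq0 => [/allP y0|i _]; last exact: sqr_ge0.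
apply/colP => i; rewrite mxE; apply: eq0_normc; apply/eqP.
by rewrite -sqrf_eq0; apply: y0; rewrite mem_index_enum.
Qed.

Lemma qformC1 y : qformC 1%:M y = (sqnorm y)%:C%C.
Proof.
rewrite /qform mulmx1 mxE rmorph_sum; apply: eq_bigr => i _.
rewrite !mxE; case: (y i 0) => a b /=.
rewrite sqr_sqrtr ?addr_ge0 ?sqr_ge0 //.
by congr Complex => /=; ring.
Qed.

Lemma qformC_lt A (h : R) y :
  (forall y', qformC 1%:M y' = 1 -> normc (qformC A y') < h) ->
  0 < sqnorm y -> normc (qformC A y) < h * sqnorm y.
Proof.
move=> hA y_gt0; set s := Num.sqrt (sqnorm y).
have s2 : s ^+ 2 = sqnorm y by rewrite sqr_sqrtr // ltW.
have : normc (qformC A ((s^-1)%:C%C *: y)) < h.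
  apply: hA; rewrite qformC_scale qformC1 -rmorphM exprVn s2 mulVf ?gt_eqF //.
rewrite qformC_scale normcM exprVn s2 /= expr0n addr0 sqrtr_sqr.
by rewrite ger0_norm ?invr_ge0 ?ltW // mulrC ltr_pdivrMr.
Qed.

Lemma qformH_dominated A x : qformH 1%:M x = 1 ->
  exists2 y, qformC 1%:M y = 1 &
    quat_norm (qformH (toH A) x) <= normc (qformC A y).
Proof.
move=> x1; set h := quat_norm _.
(* If all complex unit vectors gave moduli below [h], homogeneity would yield a strict bound for
   nonzero vectors and the weak bound [hle] for all. *)
apply: contrapT => /forall2NP hN.
have hA y : qformC 1%:M y = 1 -> normc (qformC A y) < h.
  by move=> y1; have [//|/negP] := hN y; rewrite -ltNge.
have hle y : normc (qformC A y) <= h * sqnorm y.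
  have := sqnorm_ge0 y; rewrite le_eqVlt => /orP[/eqP y0|]; last first.
    by move=> /(qformC_lt hA)/ltW.
  rewrite -y0 (sqnorm0_eq0 (esym y0)) mulr0 /qform mulmx0 mxE.
  by rewrite normc0.
have [p p1 jp0] := quat_conj_to_complex (qformH (toH A) x).
set x' := x *m p%:M.
(* The splitting of the form at the identity matrix splits the squared norm, which the unit [p]
   preserves. *)
have nx' : sqnorm (map_mx (@cpart R) x') + sqnorm (map_mx (@jpart R) x') = 1.
  have := cpart_qformH 1%:M x'.
  rewrite map_mx1 qformH_mulr x1 mulr1 quat_conj_mulE p1 expr1n !qformC1.
  by rewrite conjc_real -rmorphD => -[].
have hE : h = normc (cpart (qformH (toH A) x')).
  rewrite qformH_mulr -quat_norm_cpart // !quat_normM quat_norm_conj.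
  by rewrite p1 mul1r mulr1.
have normc_conj (z : R[i]) : normc z^*%C = normc z.
  by case: z => a b /=; rewrite sqrrN.
have : h <= normc (qformC A (map_mx (@cpart R) x')) +
            normc (qformC A (map_mx (@jpart R) x')).
  by rewrite [leLHS]hE cpart_qformH (le_trans (le_normcD _ _)) // normc_conj.
move: nx' (hle (map_mx (@cpart R) x')) (hle (map_mx (@jpart R) x')).
move: (@qformC_lt A h (map_mx (@cpart R) x') hA).
move: (@qformC_lt A h (map_mx (@jpart R) x') hA).
move: (sqnorm_ge0 (map_mx (@cpart R) x')).
set a := sqnorm _; set b := sqnorm _ => a_ge0 ltb lta ab lea leb hab.
(* As [a + b = 1], one of them is positive; its bound is strict, hence so is the sum. *)
suff : h < h * a + h * b by rewrite -mulrDr ab mulr1 ltxx.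
move: a_ge0; rewrite le_eqVlt => /orP[/eqP a0|/lta lta'].
  have /ltb ltb' : 0 < b by move: ab; rewrite -a0 add0r => ->.
  by apply: le_lt_trans hab _; apply: ler_ltD.
by apply: le_lt_trans hab _; apply: ltr_leD.
Qed.

End Forms.

(** Both sets have the same greatest elements, possibly none, so [xget] returns the same value,
    default included. *)
Lemma maximum_cofinal (R : realType) (S T : set R) :
  (S `<=` T)%classic -> (forall t, T t -> exists2 s, S s & t <= s) ->
  maximum T = maximum S.
Proof.
move=> ST TS; rewrite /maximum; congr (xget 0 _).
apply/seteqP; split=> m [Xm ubm]; split.
- have [s Ss ms] := TS _ Xm.
  (* A greatest element of [T] lies below some [s] in [S], hence equals it. *)
  by rewrite (_ : m = s) //; apply/le_anti; rewrite ms ubm //; apply: ST.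
- by move=> s /ST; apply: ubm.
- exact: ST.
- by move=> t /TS[s Ss ts]; apply: le_trans ts (ubm _ Ss).
Qed.

Theorem corollary3p3 (R : realType) (n : nat) (hn : (0 < n)%N)
    (A : 'M[R[i]]_n) :
  numerical_radiusH (map_mx (@quat_of_complex R) A) = numerical_radiusC A.
Proof.
apply: maximum_cofinal.
- move=> _ [_ [y /qform_unit y1 <-] <-].
  exists (quat_of_complex (qform (@conjc R) A y)); last first.
    exact: quat_norm_complex.
  exists (map_mx (@quat_of_complex R) y); last exact: qformH_complex.
  (* With the identity seen as an embedded complex matrix, the constraint transfers like any other
     value. *)
  apply/qform_unit; rewrite -(map_mx1 (@quat_of_complex R)).
  by rewrite qformH_complex y1 rmorph1.
- move=> _ [_ [x /qform_unit x1 <-] <-].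
  have [y y1 le_xy] := qformH_dominated A x1.
  exists (normc (qform (@conjc R) A y)) => //.
  exists (qform (@conjc R) A y) => //.
  by exists y => //; apply/qform_unit.
Qed.
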